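(* The variety $\mathcal{HRL}$ of Heyting residuated lattices has the finite embeddability property: every finite partial subalgebra of any Heyting residuated lattice can be embedded into a finite Heyting residuated lattice.
   Context: A Heyting residuated lattice is an algebra $\mathbf{A}=\langle A,\wedge,\vee,\cdot,\backslash,/,\to,1\rangle$ such that $\langle A,\wedge,\vee,\cdot,\backslash,/,1\rangle$ is an integral residuated lattice (lattice, monoid, $xy\le z\iff y\le x\backslash z\iff x\le z/y$, and $1$ is the top element) and $\langle A,\wedge,\vee,\to,1\rangle$ is a Heyting algebra on the same lattice ($x\wedge y\le z\iff y\le x\to z$). A partial subalgebra of $\mathbf{A}$ is a subset $B$ with partial operations such that whenever an operation is defined on elements of $B$ its value agrees with that in $\mathbf{A}$. An embedding of a partial algebra $\mathbf{B}$ into an algebra $\mathbf{C}$ is an injective map $\varphi$ with $\varphi(f^{\mathbf{B}}(b_1,\dots,b_k))=f^{\mathbf{C}}(\varphi(b_1),\dots,\varphi(b_k))$ whenever $f^{\mathbf{B}}(b_1,\dots,b_k)$ is defined. *)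

(* Defs.v *)
From HB Require Import structures.
From mathcomp Require Import all_boot all_order.
From mathcomp Require Import monoid.
From mathcomp Require Import boolp classical_sets cardinality.

Set Implicit Arguments.
Unset Strict Implicit.
Unset Printing Implicit Defensive.

Import Order.Theory.

Local Open Scope order_scope.

(* [lres x z] is x\z, [rres z y] is z/y and [himp x z] is x -> z.  The monoid
   unit is the top element.  There is no constant for a bottom element in the
   signature, and none is required to exist. *)
HB.mixin Record isHeytingResiduated (d : Order.disp_t) T
    of Order.Lattice d T & monoid.Monoid T := {
  lres : T -> T -> T;
  rres : T -> T -> T;
  himp : T -> T -> T;
  lex1 : forall x : T, x <= 1%g;
  lresP : forall x y z : T, ((x * y)%g <= z) = (y <= lres x z);
  rresP : forall x y z : T, ((x * y)%g <= z) = (x <= rres z y);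
  himpP : forall x y z : T, (x `&` y <= z) = (y <= himp x z)
}.

#[short(type="hrlType")]
HB.structure Definition HRL (d : Order.disp_t) :=
  {T of isHeytingResiduated d T & Order.Lattice d T & monoid.Monoid T}.

Inductive hrl_binop := OpMeet | OpJoin | OpMul | OpLres | OpRres | OpImp.

Definition binop_val (d : Order.disp_t) (A : hrlType d) (f : hrl_binop) :
    A -> A -> A :=
  match f with
  | OpMeet => fun x y => x `&` y
  | OpJoin => fun x y => x `|` y
  | OpMul => fun x y => (x * y)%g
  | OpLres => fun x y => lres x y
  | OpRres => fun x y => rres x y
  | OpImp => fun x y => himp x y
  end.

(* Partial operations are option-valued; [None] means undefined. *)
Record partial_subalg (d : Order.disp_t) (A : hrlType d) := PartialSubalg {
  psub_set :> set A;
  psub_one : option psub_set;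
  psub_binop : hrl_binop -> psub_set -> psub_set -> option psub_set;
  psub_oneP : forall b, psub_one = Some b -> val b = 1%g;
  psub_binopP : forall f x y b,
    psub_binop f x y = Some b -> val b = binop_val f (val x) (val y)
}.

Definition is_embedding (d d' : Order.disp_t) (A : hrlType d)
    (B : partial_subalg A) (C : hrlType d') (phi : B -> C) : Prop :=
  [/\ injective phi,
      forall b, psub_one B = Some b -> phi b = 1%g
    & forall f x y b,
        psub_binop f x y = Some b -> phi b = binop_val f (phi x) (phi y)].

(* Main.v *)
Require Import Defs.
From mathcomp Require Import all_boot all_order.
From mathcomp Require Import monoid.
From mathcomp Require Import boolp classical_sets cardinality.
From mathcomp Require Import functions.
From HB Require Import structures.

(* Let [M] be the submonoid and meet-subsemilattice of [A] generated by [B], and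
   let [C] consist of the intersections of the basic sets
   [{x in M | u x <= b}], for [b] in [B] and [u] a join-preserving unary
   polynomial in product and meet over [M].  Residuating a basic set by an
   element of [M], with respect to product or meet, gives a basic set, so [C] is
   a Heyting residuated lattice, and [b |-> {x in M | x <= b}] embeds [B]: joins
   are preserved because each [u] preserves them.
   For finiteness, elements of [M] and polynomials [u] are values of binary
   trees with finitely many labels.  By integrality a tree that embeds in
   another has the larger value, so Kruskal's theorem (by Nash-Williams'
   minimal bad sequences) forces the family of basic sets to be finite. *)

Local Open Scope classical_set_scope.

Set Implicit Arguments.
Unset Strict Implicit.
Unset Printing Implicit Defensive.

Import Order.Theory.

(** * Well-quasi-orders and minimal bad sequences *)

Section WellQuasiOrder.
Variable T : Type.
Implicit Types (R : T -> T -> Prop) (f g : nat -> T) (S : set T).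

Definition good R f := exists i j, (i < j)%N /\ R (f i) (f j).

Definition wqo_on S R := forall f, (forall i, S (f i)) -> good R f.

(** From some [N] on, every entry has a later entry above it: otherwise the entries without one form
    a bad subsequence. Iterating this successor from [N] gives the chain. *)
Lemma wqo_on_chain R S f :
    (forall y x z, R x y -> R y z -> R x z) -> wqo_on S R ->
    (forall i, S (f i)) ->
  exists g : nat -> nat,
    forall i j, (i < j)%N -> (g i < g j)%N /\ R (f (g i)) (f (g j)).
Proof.
move=> Rtr wqoR Sf.
pose r i j := (i < j)%N /\ R (f i) (f j).
have rtr y x z : r x y -> r y z -> r x z.
  by move=> [xy Rxy] [yz Ryz]; split; [exact: ltn_trans yz | exact: Rtr Ryz].
have [N rN] : exists N, forall i, (N <= i)%N -> exists j, r i j.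
  apply: contrapT => noN.
  have /choice[h hP] N : exists i, (N <= i)%N /\ ~ exists j, r i j.
    apply: contrapT => noi; apply: noN; exists N => i Ni.
    by apply: contrapT => nr; apply: noi; exists i.
  (* Calling [h] at [i.+1] makes [k] strictly increasing. *)
  pose k n := iter n (fun i => h i.+1) (h 0).
  have kmono : {homo k : i j / (i < j)%N}.
    by apply: homo_ltn => [y x z|i]; [exact: ltn_trans | case: (hP (k i).+1)].
  have [i [j [ij Rij]]] := wqoR (f \o k) (fun i => Sf (k i)).
  have : exists j, r (k i) j by exists (k j); split; [exact: kmono|].
  by case: i {ij Rij} => [|i]; [case: (hP 0) | case: (hP (k i).+1)].
have /choice[h hP] i : exists j, (N <= i)%N -> r i j.
  by case: (leqP N i) => [/rN[j rij]|]; [exists j | exists 0].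
have Nh i : (N <= iter i h N)%N.
  by elim: i => //= i IH; have [/ltnW + _] := hP _ IH; exact: leq_trans.
exists (fun i => iter i h N).
by apply: (@homo_ltn _ (fun i => iter i h N) r rtr) => i; exact: hP (Nh i).
Qed.

(** Minimise one entry at a time: stage [n.+1] keeps the first [n] entries and makes entry [n] as
    small as badness allows. The result is the diagonal of the stages. *)
Lemma minimal_bad R (sz : T -> nat) f : ~ good R f ->
  exists g, ~ good R g /\
    forall n e, (forall i, (i < n)%N -> e i = g i) -> (sz (e n) < sz (g n))%N ->
      good R e.
Proof.
move=> badf.
pose agree n g e := forall i, (i < n)%N -> e i = g i :> T.
pose minext (p : nat * (nat -> T)) g := ~ good R p.2 ->
  [/\ ~ good R g, agree p.1 p.2 g
    & forall e, ~ good R e -> agree p.1 p.2 e -> (sz (g p.1) <= sz (e p.1))%N].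
have /choice[F FP] p : exists g, minext p g.
  case: p => n g0; have [good0|bad0] := pselect (good R g0).
    by exists g0 => /(_ good0).
  pose P m := `[< exists g, [/\ ~ good R g, agree n g0 g & sz (g n) = m] >].
  have Pex : exists m, P m by exists (sz (g0 n)); apply/asboolP; exists g0.
  case: (ex_minnP Pex) => m /asboolP[g [badg ag szg]] minm.
  exists g => _; split=> // e bade age; rewrite szg minm //.
  by apply/asboolP; exists e.
pose G := fix G n := if n is n'.+1 then F (n', G n') else f.
have badG n : ~ good R (G n) by elim: n => //= n /(FP (n, _))[].
have agG n : agree n (G n) (G n.+1) by have [] := FP (n, G n) (badG n).
(* Entry [n] is settled at stage [n.+1], so the diagonal agrees with [G m] below [m] and inherits
   badness. *)
have GE m n : (n < m)%N -> G m n = G n.+1 n.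
  elim: m => // m IH; rewrite ltnS leq_eqVlt => /predU1P[-> //|nm].
  by rewrite agG // IH.
exists (fun n => G n.+1 n); split=> [[i [j [ij Rij]]]|n e age].
  apply: (badG j.+1); exists i, j; split=> //.
  by rewrite (GE j.+1 i) // ltnS ltnW.
rewrite ltnNge => /negP nle; apply: contrapT => bade; apply: nle.
have [_ _] := FP (n, G n) (badG n).
by apply=> // i ltin; rewrite age //= GE.
Qed.

Lemma finite_eq_good f : finite_set [set: T] -> good eq f.
Proof.
move=> finT; apply: contrapT => badf.
have finj : injective f.
  move=> i j fij; have [ij|ji|//] := ltngtP i j; case: badf.
    by exists i, j.
  by exists j, i.
have : finite_set (f @^-1` [set: T]).
  by apply: finite_preimage finT => i j _ _; exact: finj.
by rewrite preimage_setT; exact: infinite_nat.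
Qed.

End WellQuasiOrder.

(** * Kruskal's theorem for binary trees, for any preorder containing tree embedding *)

Inductive tree (L : Type) : Type :=
| Leaf of L
| Node of bool & tree L & tree L.

Section Kruskal.
Variables (L : Type) (R : tree L -> tree L -> Prop).
Hypothesis finL : finite_set [set: L].
Hypothesis R_refl : forall t, R t t.
Hypothesis R_trans : forall t s u, R s t -> R t u -> R s u.
Hypothesis R_node : forall o s t s' t',
  R s s' -> R t t' -> R (Node o s t) (Node o s' t').
Hypothesis R_left : forall o r s t, R r s -> R r (Node o s t).
Hypothesis R_right : forall o r s t, R r t -> R r (Node o s t).

Fixpoint tree_size (t : tree L) : nat :=
  if t is Node _ l r then (tree_size l + tree_size r).+1 else 0.

Definition child (s t : tree L) : Prop :=
  if t is Node _ l r then s = l \/ s = r else False.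

Lemma child_size s t : child s t -> (tree_size s < tree_size t)%N.
Proof. by case: t => //= o l r [] ->; rewrite ltnS ?leq_addr ?leq_addl. Qed.

Lemma R_child r s t : child s t -> R r s -> R r t.
Proof. by case: t => //= o l m [] -> ?; [apply: R_left | apply: R_right]. Qed.

Definition root_label (t : tree L) : L + bool :=
  match t with Leaf l => inl l | Node o _ _ => inr o end.

Definition left_child (t : tree L) : tree L :=
  if t is Node _ l _ then l else t.
Definition right_child (t : tree L) : tree L :=
  if t is Node _ _ r then r else t.

(** A bad sequence of children, spliced onto an initial part of [f], would be bad and smaller than
    [f] at the splice. *)
Lemma minimal_bad_children f :
    ~ good R f ->
    (forall n e, (forall i, (i < n)%N -> e i = f i) ->
       (tree_size (e n) < tree_size (f n))%N -> good R e) ->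
  wqo_on [set s | exists i, child s (f i)] R.
Proof.
move=> badf minf g /choice[h hP]; apply: contrapT => badg.
(* Splicing at the least parent index puts every later parent at or beyond the splice, so a good
   pair across it lifts to a good pair of [f]. *)
have [k0 hk0] : exists k0, forall k, (h k0 <= h k)%N.
  have Pex : exists m, `[< exists k, h k = m >].
    by exists (h 0); apply/asboolP; exists 0.
  case: (ex_minnP Pex) => m /asboolP[k0 <-] mink; exists k0 => k.
  by apply: mink; apply/asboolP; exists k.
pose e i := if (i < h k0)%N then f i else g (k0 + (i - h k0)).
have [||i [j [ij]]] := minf (h k0) e.
- by move=> i ltin; rewrite /e ltin.
- by rewrite /e ltnn subnn addn0; exact: child_size.
rewrite /e; have [ji0|j0] := ltnP j (h k0).
  by rewrite (ltn_trans ij ji0) => Rij; apply: badf; exists i, j.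
have [i0|i0] := ltnP i (h k0) => Rij.
  apply: badf; exists i, (h (k0 + (j - h k0))); split.
    exact: leq_trans (hk0 _).
  exact: R_child Rij.
apply: badg; exists (k0 + (i - h k0)), (k0 + (j - h k0)).
by rewrite ltn_add2l ltn_sub2r // (leq_ltn_trans i0).
Qed.

(** In a minimal bad sequence, pass to a constant root label. A leaf label makes two entries equal;
    for nodes, take a chain of left children, then a good pair among the matching right children. *)
Lemma kruskal : wqo_on [set: tree L] R.
Proof.
move=> f0 _; apply: contrapT => /(minimal_bad tree_size)[f [badf minf]].
have wqoS := minimal_bad_children badf minf.
have finK : finite_set [set: L + bool].
  apply: (@sub_finite_set _ _ (inl @` [set: L] `|` inr @` [set: bool])).
    by move=> [l|b] _; [left; exists l | right; exists b].
  by rewrite finite_setU; split; apply: finite_image => //; exact: finite_finset.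
have eq_wqo : wqo_on [set: L + bool] eq.
  by move=> k _; exact: finite_eq_good.
have [k kP] := wqo_on_chain (fun y x z xy yz => etrans xy yz) eq_wqo
  (f := root_label \o f) (fun=> I).
have kmono i j : (i < j)%N -> (k i < k j)%N by move=> /kP[].
have rootk i : root_label (f (k i)) = root_label (f (k 0)).
  by case: i => // i; have [] := kP 0 i.+1.
case root0 : (root_label (f (k 0))) => [l|o].
  have fk i : f (k i) = Leaf l.
    by move: (rootk i); rewrite root0; case: (f (k i)) => //= ? [->].
  by apply: badf; exists (k 0), (k 1); rewrite !fk; split; [exact: kmono|].
have fk i : f (k i) = Node o (left_child (f (k i))) (right_child (f (k i))).
  by move: (rootk i); rewrite root0; case: (f (k i)) => //= ? ? ? [->].
have [|g gP] := wqo_on_chain R_trans wqoS (f := left_child \o f \o k).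
  by move=> i; exists (k i); rewrite /= [f (k i)]fk; left.
have [|i [j [ij Rij]]] := wqoS (right_child \o f \o k \o g).
  by move=> i; exists (k (g i)); rewrite /= [f (k _)]fk; right.
have [gij Lij] := gP i j ij.
apply: badf; exists (k (g i)), (k (g j)); split; first exact: kmono.
by rewrite fk [f (k (g j))]fk; apply: R_node.
Qed.

End Kruskal.

(** * Terms in product and meet, and their values *)

Section Terms.
Variables (d : Order.disp_t) (A : hrlType d) (L : Type) (v : L -> A).
Implicit Types (x y z : A) (u : A -> A) (X Y Z D : set A).

(* The label [None] is the argument of a unary polynomial, [Some None] is the
   monoid unit; [true] nodes are products and [false] nodes are meets. *)
Definition term := tree (option (option L)).

Fixpoint eval x (t : term) : A :=
  match t with
  | Leaf l => oapp (oapp v 1%g) x l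
  | Node o s t => if o then (eval x s * eval x t)%g else (eval x s `&` eval x t)%O
  end.

Fixpoint subst (s t : term) : term :=
  match s with
  | Leaf None => t
  | Leaf (Some l) => Leaf (Some l)
  | Node o s1 s2 => Node o (subst s1 t) (subst s2 t)
  end.

Lemma eval_subst x s t : eval x (subst s t) = eval (eval x t) s.
Proof. by elim: s => [[]|o s1 IH1 s2 IH2] //=; rewrite IH1 IH2. Qed.

Lemma leM2 x x' y y' : (x <= x')%O -> (y <= y')%O -> (x * y <= x' * y')%O%g.
Proof.
move=> xx' yy'; apply: (@le_trans _ _ (x * y')%g).
  by rewrite lresP (le_trans yy') // -lresP.
by rewrite rresP (le_trans xx') // -rresP.
Qed.

Lemma leMl x y : (x * y <= x)%O%g.
Proof. by rewrite -[leRHS]mulg1 leM2 // Defs.lex1. Qed.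

Lemma leMr x y : (x * y <= y)%O%g.
Proof. by rewrite -[leRHS]mul1g leM2 // Defs.lex1. Qed.

Lemma eval_mono x y t : (x <= y)%O -> (eval x t <= eval y t)%O.
Proof.
move=> xy; elim: t => [[]|[] s IHs t IHt] //=; first exact: leM2.
exact: leI2.
Qed.

Definition term_ge (s t : term) : Prop := forall x, (eval x t <= eval x s)%O.

(** Both operations are monotone, and by integrality a product, like a meet, lies below its factors;
    so [term_ge] contains tree embedding. *)
Lemma term_ge_wqo : finite_set [set: L] -> wqo_on setT term_ge.
Proof.
move=> finL.
have finO (T : Type) : finite_set [set: T] -> finite_set [set: option T].
  move=> finT; apply: (@sub_finite_set _ _ (None |` Some @` [set: T])).
    by move=> [t|] _; [right; exists t | left].
  by rewrite finite_setU; split=> //; apply: finite_image.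
apply: kruskal => [|t x|t s r st tr x|o s t s' t' ss' tt' x|o r s t rs x|o r s t rt x].
- exact/finO/finO.
- exact: lexx.
- exact: le_trans (tr x) (st x).
- by case: o => /=; [exact: leM2 | exact: leI2].
- by apply: le_trans (rs x); case: o => /=; [exact: leMl | exact: leIl].
- by apply: le_trans (rt x); case: o => /=; [exact: leMr | exact: leIr].
Qed.

(** At [1] the argument leaf takes the value of the unit leaf, so terms containing it add no new
    elements. *)
Definition generated : set A := range (eval 1%g).

Lemma generated1 : generated 1%g.
Proof. by exists (Leaf None). Qed.

Lemma generatedM x y : generated x -> generated y -> generated (x * y)%g.
Proof. by move=> [s _ <-] [t _ <-]; exists (Node true s t). Qed.

Lemma generatedI x y : generated x -> generated y -> generated (x `&` y)%O.
Proof. by move=> [s _ <-] [t _ <-]; exists (Node false s t). Qed.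

Lemma generated_gen l : generated (v l).
Proof. by exists (Leaf (Some (Some l))). Qed.

Lemma generated_closed_term x : generated x -> exists t, forall y, eval y t = x.
Proof.
by move=> [t _ <-]; exists (subst t (Leaf (Some None))) => y; rewrite eval_subst.
Qed.

(** * Join-preserving unary polynomials and basic sets *)

Definition preserves_join u := forall x y, u (x `|` y)%O = (u x `|` u y)%O.

(** A term that repeats its argument, such as a square, need not preserve joins, so this is demanded
    separately. *)
Definition section u := preserves_join u /\ exists t, u =1 eval^~ t.

Lemma section_generated u x : section u -> generated x -> generated (u x).
Proof. by move=> [_ [t ->]] [s _ <-]; exists (subst t s); rewrite ?eval_subst. Qed.

Lemma section_id : section id.
Proof. by split=> //; exists (Leaf None). Qed.

Lemma section_comp u w : section u -> section w -> section (u \o w).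
Proof.
move=> [uU [s us]] [wU [t wt]]; split=> [x y|]; first by rewrite /= wU uU.
by exists (subst s t) => x; rewrite /= eval_subst wt us.
Qed.

Lemma section_mono u x y : section u -> (x <= y)%O -> (u x <= u y)%O.
Proof. by move=> [_ [t ut]] xy; rewrite !ut eval_mono. Qed.

Lemma le_eqP x y : (forall z, (x <= z)%O = (y <= z)%O) -> x = y.
Proof. by move=> E; apply/le_anti; rewrite E lexx -E lexx. Qed.

(** A translation preserves joins because it has a right adjoint: [lres] here, [rres] and [himp] in
    the next two lemmas. *)
Lemma section_mull x : generated x -> section (fun y => x * y)%g.
Proof.
move=> /generated_closed_term[t tx]; split=> [y z|].
  by apply: le_eqP => w; rewrite leUx !lresP leUx.
by exists (Node true t (Leaf None)) => y /=; rewrite tx.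
Qed.

Lemma section_mulr x : generated x -> section (fun y => y * x)%g.
Proof.
move=> /generated_closed_term[t tx]; split=> [y z|].
  by apply: le_eqP => w; rewrite leUx !rresP leUx.
by exists (Node true (Leaf None) t) => y /=; rewrite tx.
Qed.

Lemma section_meetl x : generated x -> section (fun y => x `&` y)%O.
Proof.
move=> /generated_closed_term[t tx]; split=> [y z|].
  by apply: le_eqP => w; rewrite leUx !himpP leUx.
by exists (Node false t (Leaf None)) => y /=; rewrite tx.
Qed.

Definition basic_set u l : set A := [set x | generated x /\ (u x <= v l)%O].

Definition basic : set (set A) :=
  [set D | exists u l, section u /\ D = basic_set u l].

(* An infinite family of basic sets contains an increasing sequence [E n] of
   distinct members; points [x n] in [E n.+1] but not in [E n] then contradict
   the fact that some [i < j] has [x j <= x i]. *)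
Lemma finite_basic : finite_set [set: L] -> finite_set basic.
Proof.
move=> finL; apply: contrapT => /infiniteP/pcard_leP[D].
have Dbasic n : basic (D n) by apply: (@funS _ _ _ _ D).
have Dinj : injective D by move=> i j; apply: (@inj _ _ _ D); rewrite in_setT.
have /choice[t tP] n : exists t, exists l, D n = basic_set (eval^~ t) l.
  have [u [l [[_ [t ut]] ->]]] := Dbasic n.
  by exists t, l; congr basic_set; apply/funext.
have /choice[l lP] := tP.
have eq_wqo : wqo_on [set: L] eq by move=> f _; exact: finite_eq_good.
have [k kP] := wqo_on_chain (fun s r q => @etrans L r s q) eq_wqo
  (f := l) (fun=> I).
have term_ge_trans r s t' : term_ge s r -> term_ge r t' -> term_ge s t'.
  by move=> sr rt x; exact: le_trans (rt x) (sr x).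
have [g gP] := wqo_on_chain term_ge_trans (term_ge_wqo finL) (f := t \o k)
  (fun=> I).
have lk i j : (i < j)%N -> l (k i) = l (k j) by case/kP.
pose E n := D (k (g n)).
have Esub i j : (i < j)%N -> E i `<=` E j.
  move=> ij x; rewrite /E !lP => -[Mx le_x]; split=> //.
  have [gij tij] := gP i j ij.
  by rewrite -(lk _ _ gij); exact: le_trans (tij x) le_x.
have /choice[s sP] n : exists s, E n.+1 (eval 1%g s) /\ ~ E n (eval 1%g s).
  apply: contrapT => noS.
  have : E n = E n.+1.
    apply/seteqP; split=> [|x]; first exact: Esub.
    move=> Ex; apply: contrapT => nEx.
    have [[s _ sx] _] : generated x /\ True.
      by move: Ex; rewrite /E lP => -[].
    by apply: noS; exists s; rewrite sx.
  move=> /Dinj kk; have [gn _] := gP n n.+1 (ltnSn n).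
  by have [] := kP _ _ gn; rewrite kk ltnn.
have [i [j [ij /(_ 1%g) le_ji]]] := term_ge_wqo finL (f := s) (fun=> I).
have [Ei _] := sP i; have [_] := sP j; apply.
have : E j (eval 1%g (s i)).
  by move: ij; rewrite leq_eqVlt => /predU1P[<-//|ij]; exact: Esub Ei.
rewrite /E lP => -[_ le_si]; split; first by exists (s j).
by apply: le_trans le_si; exact: eval_mono.
Qed.

(** * Closed sets: intersections of basic sets *)

Definition closure X : set A :=
  [set y | generated y /\ forall D, basic D -> X `<=` D -> D y].

Definition closed X := closure X = X.

Lemma basic_generated D : basic D -> D `<=` generated.
Proof. by move=> [u [l [_ ->]]] x []. Qed.

Lemma closed_generated X : closed X -> X `<=` generated.
Proof. by move=> <- x []. Qed.

Lemma sub_closure X : X `<=` generated -> X `<=` closure X.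
Proof. by move=> XM x Xx; split=> [|D _]; [exact: XM | exact]. Qed.

Lemma closedP X : X `<=` generated -> closure X `<=` X -> closed X.
Proof. by move=> XM cX; apply/seteqP; split=> //; exact: sub_closure. Qed.

Lemma closure_closed X : closed (closure X).
Proof.
apply: closedP => [x []//|x [Mx cx]]; split=> // D bD XD.
by apply: cx => // y [_ cy]; exact: cy.
Qed.

Lemma closure_sub X Z : closed Z -> X `<=` Z -> closure X `<=` Z.
Proof.
move=> <- XZ x [Mx cx]; split=> // D bD ZD; apply: cx => // y /XZ[My].
exact.
Qed.

Lemma closed_basic D : basic D -> closed D.
Proof.
move=> bD; apply: closedP; first exact: basic_generated.
by move=> x [_ cx]; apply: cx.
Qed.

(** Sections are monotone, so basic sets are downward closed in [generated], and so are their
    intersections. *)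
Lemma closed_down Z x y :
  closed Z -> Z x -> generated y -> (y <= x)%O -> Z y.
Proof.
move=> <- [_ cx] My yx; split=> // D bD ZD; have := cx D bD ZD.
case: bD => u [l [su ->]] [_ ux]; split=> //.
by apply: le_trans ux; exact: section_mono.
Qed.

(** [closure] takes the empty intersection to be [generated], so no basic set has to contain it. *)
Lemma closed_setT : closed generated.
Proof. by apply: closedP => // x []. Qed.

Lemma closed_setI X Y : closed X -> closed Y -> closed (X `&` Y).
Proof.
move=> cX cY; apply: closedP => [x [/(closed_generated cX)]//|x xXY].
by split; apply: (closure_sub _ _ xXY) => // z [].
Qed.

(** With [I] the left translations, right translations or meets by the elements of a set, this gives
    the two residuals and the implication. *)
Definition residual (I : set (A -> A)) Z : set A :=
  [set y | generated y /\ forall u, I u -> Z (u y)].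

(** Pulling the basic set of [w] back along a section [u] gives the basic set of [w \o u]. *)
Lemma closed_residual (I : set (A -> A)) Z :
  (forall u, I u -> section u) -> closed Z -> closed (residual I Z).
Proof.
move=> sI cZ; apply: closedP => [x []//|x [Mx cx]]; split=> // u Iu.
have su := sI u Iu.
rewrite -cZ; split=> [|_ [w [l [sw ->]]] ZD]; first exact: section_generated.
split; first exact: section_generated.
have [||_ //] := cx (basic_set (w \o u) l).
  by exists (w \o u), l; split=> //; exact: section_comp.
by move=> y [My /(_ u Iu)/ZD[]].
Qed.

(** * The Heyting residuated lattice of closed sets *)

Record galois := Galois { gset :> set A; gset_closed : `[< closed gset >] }.

HB.instance Definition _ := [isSub for gset].
HB.instance Definition _ := [Choice of galois by <:].

Implicit Types G H K : galois.

Lemma galoisP G : closed G.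
Proof. exact/asboolP/gset_closed. Qed.

Definition mkgalois X (cX : closed X) : galois := Galois (asboolT cX).

Definition gle G H : bool := `[< G `<=` H >].

Lemma gle_refl : reflexive gle.
Proof. by move=> G; apply/asboolP. Qed.

Lemma gle_anti : antisymmetric gle.
Proof.
move=> G H /andP[/asboolP GH /asboolP HG]; apply/val_inj/seteqP.
by split.
Qed.

Lemma gle_trans : transitive gle.
Proof.
move=> G H K /asboolP HG /asboolP GK; apply/asboolP.
exact: subset_trans GK.
Qed.

HB.instance Definition _ :=
  Order.Le_isPOrder.Build set_display galois gle_refl gle_anti gle_trans.

Lemma galois_leP G H : reflect (G `<=` H) (G <= H)%O.
Proof. exact: asboolP. Qed.

Definition gmeet G H : galois := mkgalois (closed_setI (galoisP G) (galoisP H)).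
Definition gjoin G H : galois := mkgalois (closure_closed (G `|` H)).

Lemma gmeetP G H K : (G <= gmeet H K)%O = (G <= H)%O && (G <= K)%O.
Proof.
apply/galois_leP/andP => [GHK|[/galois_leP GH /galois_leP GK]].
  by split; apply/galois_leP => x /GHK[].
by move=> x Gx; split; [exact: GH | exact: GK].
Qed.

Lemma gjoinP G H K : (gjoin G H <= K)%O = (G <= K)%O && (H <= K)%O.
Proof.
apply/galois_leP/andP => [GHK|[/galois_leP GK /galois_leP HK]]; last first.
  by apply: closure_sub; [exact: galoisP | rewrite subUset].
have sGH : G `|` H `<=` closure (G `|` H).
  by apply: sub_closure; rewrite subUset; split; apply/closed_generated/galoisP.
by split; apply/galois_leP => x ?; apply/GHK/sGH; [left | right].
Qed.

HB.instance Definition _ :=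
  Order.POrder_MeetJoin_isLattice.Build set_display galois gmeetP gjoinP.

Definition set_mul X Y : set A := [set (x * y)%g | x in X & y in Y].

Definition gone : galois := mkgalois closed_setT.
Definition gmul G H : galois := mkgalois (closure_closed (set_mul G H)).

Lemma lmul_section G u : [set (fun y => x * y)%g | x in G] u -> section u.
Proof. by move=> [x /(closed_generated (galoisP G))/section_mull + <-]. Qed.

Lemma rmul_section G u : [set (fun y => y * x)%g | x in G] u -> section u.
Proof. by move=> [x /(closed_generated (galoisP G))/section_mulr + <-]. Qed.

Lemma meet_section G u : [set (fun y => x `&` y)%O | x in G] u -> section u.
Proof. by move=> [x /(closed_generated (galoisP G))/section_meetl + <-]. Qed.

Definition glres G K : galois :=
  mkgalois (closed_residual (@lmul_section G) (galoisP K)).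
Definition grres K H : galois :=
  mkgalois (closed_residual (@rmul_section H) (galoisP K)).
Definition ghimp G K : galois :=
  mkgalois (closed_residual (@meet_section G) (galoisP K)).

Lemma galois_generated G x : gset G x -> generated x.
Proof. exact: closed_generated (galoisP G) x. Qed.

Lemma gmul_leP G H K :
  reflect (forall x y, gset G x -> gset H y -> gset K (x * y)%g) (gmul G H <= K)%O.
Proof.
apply: (iffP (galois_leP _ _)) => [GHK x y Gx Hy|GHK].
  apply/GHK/sub_closure; last by exists x => //; exists y.
  move=> _ [a /galois_generated Ma [b /galois_generated Mb <-]].
  exact: generatedM.
by apply: closure_sub; [exact: galoisP | move=> _ [x Gx [y Hy <-]]; exact: GHK].
Qed.

Lemma glresP G H K : (gmul G H <= K)%O = (H <= glres G K)%O.
Proof.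
apply/gmul_leP/galois_leP => [GHK y Hy|HGK x y Gx /HGK[_ Ky]].
  by split=> [|_ [x Gx <-]]; [exact: galois_generated Hy | exact: GHK].
by apply: (Ky (fun z => x * z)%g); exists x.
Qed.

Lemma grresP G H K : (gmul G H <= K)%O = (G <= grres K H)%O.
Proof.
apply/gmul_leP/galois_leP => [GHK x Gx|GKH x y /GKH[_ Kx] Hy].
  by split=> [|_ [y Hy <-]]; [exact: galois_generated Gx | exact: GHK].
by apply: (Kx (fun z => z * y)%g); exists y.
Qed.

Lemma ghimpP G H K : (gmeet G H <= K)%O = (H <= ghimp G K)%O.
Proof.
apply/galois_leP/galois_leP => [GHK y Hy|HGK x [Gx /HGK[_ Kx]]]; last first.
  by rewrite -[x]meetxx; apply: (Kx (fun z => x `&` z)%O); exists x.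
have My := galois_generated Hy; split=> // _ [x Gx <-].
have Mxy := generatedI (galois_generated Gx) My.
apply: GHK; split.
  exact: (closed_down (galoisP G) Gx Mxy (leIl _ _)).
exact: (closed_down (galoisP H) Hy Mxy (leIr _ _)).
Qed.

Lemma gle1 G : (G <= gone)%O.
Proof. by apply/galois_leP => x; exact: galois_generated. Qed.

Lemma galois_eqP G H : (forall K, (G <= K)%O <-> (H <= K)%O) -> G = H.
Proof. by move=> E; apply/le_anti/andP; split; apply/E. Qed.

(** Both bracketings have the same upper bounds [W]: after residuating, each bound says that all
    threefold products lie in [W]. *)
Lemma gmulA : associative gmul.
Proof.
move=> G H K; apply: galois_eqP => W; rewrite glresP [(gmul (gmul G H) K <= W)%O]grresP.
split=> /gmul_leP GHK; apply/gmul_leP => x y.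
  move=> Gx Hy; split=> [|_ [z Kz <-]].
    by apply: generatedM; [exact: galois_generated Gx|exact: galois_generated Hy].
  rewrite -mulgA; have [_] := GHK y z Hy Kz.
  by apply; exists x.
move=> Hx Ky; split=> [|_ [z Gz <-]].
  by apply: generatedM; [exact: galois_generated Hx|exact: galois_generated Ky].
rewrite mulgA; have [_] := GHK z x Gz Hx.
by move=> /(_ (fun a => a * y)%g); apply; exists y.
Qed.

Lemma gmul1g : left_id gone gmul.
Proof.
move=> G; apply: galois_eqP => W; split=> [/gmul_leP GW|/galois_leP GW].
  by apply/galois_leP => x Gx; rewrite -[x]mul1g; apply: GW; [exact: generated1|].
apply/gmul_leP => x y Mx Gy; apply: GW.
by apply: (closed_down (galoisP G) Gy) (leMr _ _); apply: generatedM Mx _;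
  exact: galois_generated Gy.
Qed.

Lemma gmulg1 : right_id gone gmul.
Proof.
move=> G; apply: galois_eqP => W; split=> [/gmul_leP GW|/galois_leP GW].
  by apply/galois_leP => x Gx; rewrite -[x]mulg1; apply: GW; [|exact: generated1].
apply/gmul_leP => x y Gx My; apply: GW.
by apply: (closed_down (galoisP G) Gx) (leMl _ _); apply: generatedM _ My;
  exact: galois_generated Gx.
Qed.

HB.instance Definition _ := isMonoid.Build galois gmulA gmul1g gmulg1.

HB.instance Definition _ := isHeytingResiduated.Build set_display galois
  gle1 glresP grresP ghimpP.

(** A closed set is determined by the basic sets containing it, which [code] records as a bit
    vector. *)
Lemma finite_galois : finite_set [set: L] -> finite_set [set: galois].
Proof.
move=> /finite_basic/finite_seqP[s basicE].
pose code G := [tuple `[< G `<=` tnth (in_tuple s) i >] | i < size s].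
have codeP G H : code G = code H -> G `<=` H.
  move=> GH x Gx; rewrite -(galoisP H); split=> [|D].
    exact: galois_generated Gx.
  rewrite basicE /= => Ds HD; suff : G `<=` D by exact.
  have /tnthP[i Di] : D \in in_tuple s by [].
  have := congr1 (fun c => tnth c i) GH; rewrite /code !tnth_mktuple -Di => E.
  by apply/asboolP; rewrite E; apply/asboolP.
have : finite_set (code @^-1` setT).
  apply: finite_preimage; last exact: finite_finset.
  by move=> G H _ _ GH; apply/val_inj/seteqP; split; apply: codeP.
by rewrite preimage_setT.
Qed.

(** * The embedding by principal closed sets *)

Lemma basic_principal l : basic (basic_set id l).
Proof. by exists id, l; split=> //; exact: section_id. Qed.

Definition principal l : galois := mkgalois (closed_basic (basic_principal l)).

Lemma principal_gen l : gset (principal l) (v l).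
Proof. by split=> //; exact: generated_gen. Qed.

Lemma principal_le_inj i j : principal i = principal j -> (v i <= v j)%O.
Proof. by move=> E; have := principal_gen i; rewrite E => -[]. Qed.

Lemma principal_inj i j : principal i = principal j -> v i = v j.
Proof. by move=> E; apply/le_anti; rewrite !principal_le_inj. Qed.

Lemma principal_one l : v l = 1%g -> principal l = 1%g.
Proof.
move=> vl; apply/val_inj/seteqP; split=> x /=; first by case.
by move=> Mx; split=> //; rewrite vl Defs.lex1.
Qed.

(** Each [v i] is the greatest element of [principal i], so products, residuals and implications of
    principal sets are decided at these elements. *)
Lemma principal_binop f i j k :
  v k = binop_val f (v i) (v j) ->
  principal k = binop_val f (principal i) (principal j).
Proof.
case: f => /= vk.
- apply/val_inj/seteqP; split=> x /=.
    by rewrite /basic_set /= vk lexI => -[Mx /andP[]].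
  by move=> [[Mx xi] [_ xj]]; split=> //; rewrite vk lexI xi.
- apply/le_anti/andP; split; last first.
    by rewrite leUx; apply/andP; split; apply/galois_leP => x [Mx xl]; split=> //;
      rewrite vk (le_trans xl) // ?leUl ?leUr.
  (* A basic set of [u] containing both principal sets bounds [u (v i)] and [u (v j)], hence
     [u (v k)], as [u] preserves joins. *)
  apply/galois_leP => x [Mx xk]; split=> // _ [u [l [su ->]]] ijD.
  split=> //; apply: le_trans (section_mono su xk) _; rewrite vk.
  have [-> _] := su; rewrite leUx.
  have [_ ->] : basic_set u l (v i) by apply/ijD; left; exact: principal_gen.
  by have [_ ->] : basic_set u l (v j) by apply/ijD; right; exact: principal_gen.
- apply/le_anti/andP; split; last first.
    apply/gmul_leP => x y [Mx xi] [My yj]; split; first exact: generatedM.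
    by rewrite vk leM2.
  apply/galois_leP => x [Mx xk].
  apply: (closed_down (galoisP _) _ Mx xk); rewrite vk.
  apply/(elimT (gmul_leP _ _ _) (lexx _)); exact: principal_gen.
- apply/val_inj/seteqP; split=> x /= [Mx].
    rewrite vk => xk; split=> // _ [y [My yi] <-].
    split; first exact: generatedM.
    by apply: le_trans (leM2 yi (lexx x)) _; rewrite lresP.
  move=> /(_ (fun z => v i * z)%g)[|_ xk]; last by split=> //; rewrite vk -lresP.
  by exists (v i) => //; exact: principal_gen.
- apply/val_inj/seteqP; split=> x /= [Mx].
    rewrite vk => xk; split=> // _ [y [My yj] <-].
    split; first exact: generatedM.
    by apply: le_trans (leM2 (lexx x) yj) _; rewrite rresP.
  move=> /(_ (fun z => z * v j)%g)[|_ xk]; last by split=> //; rewrite vk -rresP.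
  by exists (v j) => //; exact: principal_gen.
- apply/val_inj/seteqP; split=> x /= [Mx].
    rewrite vk => xk; split=> // _ [y [My yi] <-].
    split; first exact: generatedI.
    by apply: le_trans (leI2 yi (lexx x)) _; rewrite himpP.
  move=> /(_ (fun z => v i `&` z)%O)[|_ xk]; last by split=> //; rewrite vk -himpP.
  by exists (v i) => //; exact: principal_gen.
Qed.

End Terms.

Theorem theorem5p14 (d : Order.disp_t) (A : hrlType d) (B : partial_subalg A) :
  finite_set (psub_set B) ->
  exists (d' : Order.disp_t) (C : hrlType d') (phi : psub_set B -> C),
    finite_set [set: C] /\ is_embedding phi.
Proof.
move=> finB.
have finL : finite_set [set: psub_set B].
  have : finite_set ((val : psub_set B -> A) @^-1` psub_set B).
    by apply: finite_preimage finB => x y _ _; exact: val_inj.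
  by apply: sub_finite_set => x _; exact: set_valP.
(* The labels are the elements of [B], valued by inclusion into [A]. *)
exists set_display, (galois (val : psub_set B -> A)), (principal _).
split; first exact: finite_galois.
split=> [x y xy|b /psub_oneP|f x y b /psub_binopP].
- exact/val_inj/(principal_inj xy).
- exact: principal_one.
- exact: principal_binop.
Qed.
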